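(* Let $\varepsilon_{\mathrm{out}}>0$, $\lambda_0\in\mathbb{R}^m$, $R_{\mathrm d}=\|\lambda_0-\lambda^*\|>0$, and put $$k_{\mathrm{out}}:=\left\lfloor 2R_{\mathrm d}\sqrt{\frac{L_{\mathrm d}}{\varepsilon_{\mathrm{out}}}}\right\rfloor,\qquad \varepsilon_{\mathrm{in}}:=\frac{3}{8\left(1+\sqrt{2L_{\mathrm p}}\,R_{\mathrm p}\right)(k_{\mathrm{out}}+3)}\,\varepsilon_{\mathrm{out}} .$$ Assume that for every $\lambda\in\mathbb{R}^m$ the point $\bar z(\lambda)\in Z$ satisfies $$\min_{z\in Z}\langle \nabla\mathcal{L}_\rho(\bar z(\lambda),\lambda),\, z-\bar z(\lambda)\rangle \ge -\left(1+\sqrt{2L_{\mathrm p}}\,R_{\mathrm p}\right)\varepsilon_{\mathrm{in}} .$$ Let $\theta_0=1$, $\theta_{k+1}=\frac12\left(1+\sqrt{4\theta_k^2+1}\right)$, $S_k=\sum_{j=0}^k\theta_j$, $a_{k+1}=S_{k+1}^{-1}\theta_{k+1}$, let $(\lambda_k)_{k\ge0}$, $(\mu_k)_{k\ge0}$ be generated by the inexact dual fast gradient method $$\mu_k=\lambda_k+L_{\mathrm d}^{-1}\nabla\bar d_\rho(\lambda_k),\qquad \lambda_{k+1}=(1-a_{k+1})\mu_k+a_{k+1}\Big[\lambda_0+L_{\mathrm d}^{-1}\sum_{i=0}^k\theta_i\nabla\bar d_\rho(\lambda_i)\Big],$$ and let $\hat z_k=S_k^{-1}\sum_{j=0}^k\theta_j\bar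 z(\lambda_j)$. Then $$f^*-d_\rho(\mu_{k_{\mathrm{out}}})\le\varepsilon_{\mathrm{out}},\qquad \hat z_{k_{\mathrm{out}}}\in Z,\qquad \|A\hat z_{k_{\mathrm{out}}}-b\|\le\frac{3}{R_{\mathrm d}}\varepsilon_{\mathrm{out}},$$ $$-\left(\frac{3\|\lambda^*\|}{R_{\mathrm d}}+\frac{9\rho}{2R_{\mathrm d}^2}\varepsilon_{\mathrm{out}}\right)\varepsilon_{\mathrm{out}}\le f(\hat z_{k_{\mathrm{out}}})-f^*\le\left(\frac{\|\lambda_0\|^2+R_{\mathrm d}^2}{2R_{\mathrm d}^2}\right)\varepsilon_{\mathrm{out}} .$$
   Context: Setting: $f:\mathbb{R}^n\to\mathbb{R}$ is convex and differentiable, $A\in\mathbb{R}^{m\times n}$ has full row rank, $b\in\mathbb{R}^m$, $Z\subset\mathbb{R}^n$ is nonempty, compact and convex, $\rho>0$; $\|\cdot\|$ and $\langle\cdot,\cdot\rangle$ are the Euclidean norm and inner product; $\lfloor\cdot\rfloor$ is the integer floor. Primal problem: $f^*=\min\{f(z): Az=b,\ z\in Z\}$. Augmented Lagrangian: $\mathcal{L}_\rho(z,\lambda)=f(z)+\langle\lambda,Az-b\rangle+\frac\rho2\|Az-b\|^2$; $\nabla\mathcal{L}_\rho$ denotes its gradient in $z$, assumed Lipschitz continuous in $z$ on $\mathbb{R}^n$ with constant $L_{\mathrm p}>0$ for each $\lambda$. $R_{\mathrm p}=\max_{z,y\in Z}\|z-y\|$. Augmented dual function: $d_\rho(\lambda)=\min_{z\in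 Z}\mathcal{L}_\rho(z,\lambda)$. Slater's constraint qualification is assumed, so that $f^*=\max_{\lambda}\min_{z\in Z}\{f(z)+\langle\lambda,Az-b\rangle\}$; $\lambda^*$ denotes a maximizer of this dual problem (the ordinary dual and the problem $\max_\lambda d_\rho(\lambda)$ have the same optimal value and the same optimal solutions). $L_{\mathrm d}=1/\rho$. Inexact dual information: for each $\lambda$ an approximate minimizer $\bar z(\lambda)\in Z$ of $\mathcal{L}_\rho(\cdot,\lambda)$ over $Z$ is fixed, and $\nabla\bar d_\rho(\lambda):=A\bar z(\lambda)-b$ (a notation, not necessarily a gradient). *)

(* Defs.v *)
From HB Require Import structures.
From mathcomp Require Import all_boot all_order all_algebra.
From mathcomp Require Import all_classical all_reals all_analysis.

Set Implicit Arguments.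
Unset Strict Implicit.
Unset Printing Implicit Defensive.

Import Order.TTheory GRing.Theory Num.Theory.
Import numFieldNormedType.Exports.

Local Open Scope classical_set_scope.
Local Open Scope ring_scope.

(* Least and greatest elements of a set of reals, required to belong to the
   set; the value 0 returned when there is none carries no meaning. *)
Definition set_min (R : realType) (E : set R) : R := xget 0 (E `&` lbound E).

Definition set_max (R : realType) (E : set R) : R := xget 0 (E `&` ubound E).

Definition inner (R : realType) (n : nat) (x y : 'cV[R]_n) : R :=
  \sum_(i < n) x i 0 * y i 0.

(* The library norm `|x| on 'cV[R]_n is the sup norm, which induces the same
   topology but is not the Euclidean norm. *)
Definition enorm (R : realType) (n : nat) (x : 'cV[R]_n) : R :=
  Num.sqrt (inner x x).

Definition grad (R : realType) (n : nat) (F : 'cV[R]_n -> R) (z : 'cV[R]_n) :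
    'cV[R]_n :=
  \col_i 'D_(delta_mx i 0) F z.

Definition affine_hull (R : realType) (n : nat) (Z : set 'cV[R]_n) :
    set 'cV[R]_n :=
  [set y | exists (k : nat) (c : 'I_k -> R) (x : 'I_k -> 'cV[R]_n),
    [/\ forall i, Z (x i), \sum_(i < k) c i = 1
      & y = \sum_(i < k) c i *: x i]].

Definition relint (R : realType) (n : nat) (Z : set 'cV[R]_n) :
    set 'cV[R]_n :=
  [set z | Z z /\ \forall y \near z, affine_hull Z y -> Z y].

Section Lagrangians.
Variables (R : realType) (m n : nat).
Variables (f : 'cV[R]_n -> R) (A : 'M[R]_(m, n)) (b : 'cV[R]_m).
Variable Z : set 'cV[R]_n.

Definition feasible : set 'cV[R]_n := [set z | A *m z = b /\ Z z].

Definition slater : Prop := exists2 z, relint Z z & A *m z = b.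

Definition primal_value : R := set_min [set f z | z in feasible].

Definition lagrange_dual (lambda : 'cV[R]_m) : R :=
  set_min [set f z + inner lambda (A *m z - b) | z in Z].

Definition aug_lagrangian (rho : R) (z : 'cV[R]_n) (lambda : 'cV[R]_m) : R :=
  f z + inner lambda (A *m z - b) + rho / 2 * enorm (A *m z - b) ^+ 2.

Definition grad_aug_lagrangian (rho : R) (z : 'cV[R]_n)
    (lambda : 'cV[R]_m) : 'cV[R]_n :=
  grad (fun y => aug_lagrangian rho y lambda) z.

Definition aug_dual (rho : R) (lambda : 'cV[R]_m) : R :=
  set_min [set aug_lagrangian rho z lambda | z in Z].

End Lagrangians.

Definition diam (R : realType) (n : nat) (Z : set 'cV[R]_n) : R :=
  set_max [set enorm (p.1 - p.2) | p in Z `*` Z].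

Fixpoint theta (R : realType) (k : nat) : R :=
  if k is k'.+1 then (1 + Num.sqrt (4 * theta R k' ^+ 2 + 1)) / 2 else 1.

Definition theta_sum (R : realType) (k : nat) : R := \sum_(j < k.+1) theta R j.

(* Main.v *)
Require Import Defs.
From HB Require Import structures.
From mathcomp Require Import all_boot all_order all_algebra.
From mathcomp Require Import all_classical all_reals all_analysis.
From mathcomp Require Import ring lra.

Set Implicit Arguments.
Unset Strict Implicit.
Unset Printing Implicit Defensive.

Import Order.TTheory GRing.Theory Num.Theory.
Import numFieldNormedType.Exports.

Local Open Scope classical_set_scope.
Local Open Scope ring_scope.

(* Write g = A z - b at z = zbar(lambda).  The approximate stationarity of z,
   combined with the convexity of f and a completion of the square in A y - b,
   gives
     d(x) >= L_rho(z, x) - delta - |x - lambda|^2 / (2 rho)   for all x,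
   while d(x) <= L_rho(z, x) is trivial and L_rho(z, .) is affine with slope g.
   So d has an inexact first-order oracle with constant exactly 1/rho, and
   Nesterov's estimate-sequence argument yields, for all x,
     sum_j theta_j L_rho(zbar_j, x) - |x - lambda_0|^2 / (2 rho)
       <= S_k d(mu_k) + (sum_j S_j) delta,
   where S_k = theta_k^2 >= (k+2)^2 / 4, so that the accumulated error relative
   to S_k is at most (k+1) delta <= 3 eps_out / 8.  The bounds follow by taking
   x = lambda_star (dual gap), x = lambda_0 + rho S_k (A zhat_k - b)
   (feasibility) and x = 0 (upper bound on f).
   Strong duality comes from quadratic penalties: a minimiser z_c of
   f + c/2 |A z - b|^2 over Z minimises the Lagrangian with multiplier
   c (A z_c - b), and f(z_c) tends to at least f* by compactness of Z. *)

(** * Euclidean inner product, Cauchy-Schwarz and Young inequalities *)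

Section InnerProduct.
Variables (R : realType) (n : nat).
Implicit Types (x y u : 'cV[R]_n) (t : R).

Lemma innerC x y : inner x y = inner y x.
Proof. by apply: eq_bigr => i _; rewrite mulrC. Qed.

Lemma innerDl x y u : inner (x + y) u = inner x u + inner y u.
Proof. by rewrite -big_split; apply: eq_bigr => i _; rewrite mxE mulrDl. Qed.

Lemma innerZl t x y : inner (t *: x) y = t * inner x y.
Proof. by rewrite /inner mulr_sumr; apply: eq_bigr => i _; rewrite mxE mulrA. Qed.

Lemma innerNl x y : inner (- x) y = - inner x y.
Proof. by rewrite -scaleN1r innerZl mulN1r. Qed.

Lemma innerDr x y u : inner u (x + y) = inner u x + inner u y.
Proof. by rewrite innerC innerDl !(innerC u). Qed.

Lemma innerZr t x y : inner x (t *: y) = t * inner x y.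
Proof. by rewrite innerC innerZl (innerC x). Qed.

Lemma innerNr x y : inner x (- y) = - inner x y.
Proof. by rewrite innerC innerNl (innerC x). Qed.

Lemma inner0r x : inner x 0 = 0.
Proof. by rewrite -(scale0r x) innerZr mul0r. Qed.

Definition innerE := (innerDl, innerDr, innerNl, innerNr, innerZl, innerZr).

Lemma inner_sumr k (F : 'I_k -> 'cV[R]_n) x :
  inner x (\sum_(i < k) F i) = \sum_(i < k) inner x (F i).
Proof.
elim: k F => [|k IHk] F; first by rewrite !big_ord0 inner0r.
by rewrite !big_ord_recr /= innerDr IHk.
Qed.

Lemma inner_ge0 x : 0 <= inner x x.
Proof. by apply: sumr_ge0 => i _; rewrite -expr2 sqr_ge0. Qed.

Lemma inner_eq0 x : (inner x x == 0) = (x == 0).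
Proof.
apply/idP/eqP => [/eqP x0|->]; last by rewrite inner0r.
apply/matrixP => i j; rewrite ord1 mxE; apply/eqP.
(* Generalising over [i] and a trivial truth gives the goal the shape of the conclusion of
   [psumr_eq0P]. *)
rewrite -sqrf_eq0 expr2; apply/eqP; move: i {j} (erefl true).
by apply: (psumr_eq0P _ x0) => i _; rewrite -expr2 sqr_ge0.
Qed.

Lemma enorm_ge0 x : 0 <= enorm x.
Proof. exact: sqrtr_ge0. Qed.

Lemma sqr_enorm x : enorm x ^+ 2 = inner x x.
Proof. by rewrite sqr_sqrtr // inner_ge0. Qed.

Lemma cauchy_schwarz x y : inner x y ^+ 2 <= inner x x * inner y y.
Proof.
have [->|y0] := eqVneq y 0; first by rewrite !inner0r mulr0 expr0n.
have yy : 0 < inner y y by rewrite lt0r inner_eq0 y0 inner_ge0.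
rewrite -subr_ge0 -(pmulr_rge0 _ yy).
have := inner_ge0 (inner y y *: x - inner x y *: y).
by rewrite !innerE (innerC y x); congr (0 <= _); ring.
Qed.

Lemma normr_inner_le x y : `|inner x y| <= enorm x * enorm y.
Proof.
rewrite -[leLHS]sqrtr_sqr -sqrtrM ?inner_ge0 //.
by rewrite ler_sqrt ?cauchy_schwarz // mulr_ge0 ?inner_ge0.
Qed.

(** Expand the square of [x - t *: y] and divide by [2 * t]; every completion of the square below is
    this with [t = rho]. *)
Lemma inner_young t x y : 0 < t ->
  inner x y <= inner x x / (2 * t) + t / 2 * inner y y.
Proof.
move=> t0; have := inner_ge0 (x - t *: y).
rewrite !innerE (innerC y x) => h.
rewrite -subr_ge0 (_ : _ - _ = (2 * t)^-1 *
  (inner x x + - (t * inner x y) +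
   (- (t * inner x y) + - (t * - (t * inner y y))))).
  by rewrite mulr_ge0 // invr_ge0; lra.
by field; apply: lt0r_neq0.
Qed.

End InnerProduct.

(** * Growth of the weights and of their partial sums *)

Section ThetaSequence.
Variable R : realType.

Lemma theta0 : theta R 0 = 1.
Proof. by []. Qed.

Lemma theta_sumS k : theta_sum R k.+1 = theta_sum R k + theta R k.+1.
Proof. by rewrite /theta_sum big_ord_recr. Qed.

Lemma theta_ge k : (k%:R + 2) / 2 <= theta R k.
Proof.
elim: k => [|k IHk]; first by rewrite /=; lra.
have t0 : 0 <= theta R k by have := ler0n R k; lra.
rewrite -natr1 /= ler_pM2r ?invr_gt0 //.
suff : 2 * theta R k <= Num.sqrt (4 * theta R k ^+ 2 + 1) by lra.
rewrite -(ger0_norm (mulr_ge0 _ t0)) // -sqrtr_sqr ler_sqrt ?exprMn; nra.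
Qed.

Lemma theta_gt0 k : 0 < theta R k.
Proof. by have := theta_ge k; have := ler0n R k; lra. Qed.

(** The recursion makes [theta R k.+1] a root of [t ^+ 2 - t = theta R k ^+ 2], so the squares
    telescope. *)
Lemma theta_sqr k : theta R k ^+ 2 = theta_sum R k.
Proof.
elim: k => [|k IHk]; first by rewrite /theta_sum big_ord1 expr1n.
rewrite theta_sumS -IHk /=; set s := Num.sqrt _.
have : s ^+ 2 = 4 * theta R k ^+ 2 + 1.
  by rewrite sqr_sqrtr // addr_ge0 // mulr_ge0 // sqr_ge0.
nra.
Qed.

Lemma theta_sum_gt0 k : 0 < theta_sum R k.
Proof. by rewrite -theta_sqr exprn_gt0 // theta_gt0. Qed.

Lemma theta_sum_ge k : (k%:R + 2) ^+ 2 / 4 <= theta_sum R k.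
Proof.
rewrite -theta_sqr; have := theta_ge k; have := ler0n R k; nra.
Qed.

Lemma sum_theta_sum_le k :
  \sum_(j < k.+1) theta_sum R j <= (k%:R + 1) * theta_sum R k.
Proof.
elim: k => [|k IHk]; first by rewrite big_ord1 add0r mul1r.
rewrite big_ord_recr /= -natr1; have := IHk.
have := theta_sumS k; have := theta_gt0 k.+1; have := ler0n R k.
move=> k0 t0 -> h; nra.
Qed.

End ThetaSequence.

(** * Fast gradient ascent with an inexact oracle *)

Local Arguments theta : simpl never.

(* The left-hand side is the estimate function of Nesterov's dual-averaging
   scheme; it is a concave quadratic maximal at the bracketed point of
   [lam_step], which is where the induction hypothesis is used. *)
Lemma fast_gradient_estimate (R : realType) (m : nat) (rho delta : R)
    (d : 'cV[R]_m -> R) (c : nat -> R) (g lam mu : nat -> 'cV[R]_m)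
    (rho_gt0 : 0 < rho)
    (d_le : forall j x, d x <= c j + inner x (g j))
    (d_ge : forall j x, c j + inner x (g j) - delta
              - inner (x - lam j) (x - lam j) / (2 * rho) <= d x)
    (mu_step : forall k, mu k = lam k + rho *: g k)
    (lam_step : forall k, theta_sum R k.+1 *: lam k.+1 =
       theta_sum R k *: mu k
       + theta R k.+1 *: (lam 0%N + rho *: \sum_(i < k.+1) theta R i *: g i))
    (k : nat) (x : 'cV[R]_m) :
  \sum_(j < k.+1) theta R j * (c j + inner x (g j))
    - inner (x - lam 0%N) (x - lam 0%N) / (2 * rho)
  <= theta_sum R k * d (mu k) + (\sum_(j < k.+1) theta_sum R j) * delta.
Proof.
have rho0 : rho != 0 by apply: lt0r_neq0.
(* Ascent step: moving by [rho *: g j] gains [rho] times the squared slope and loses half of it to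
   the quadratic term of [d_ge]. *)
have d_mu j : c j + inner (lam j) (g j) + rho / 2 * inner (g j) (g j) - delta
    <= d (mu j).
  have := d_ge j (mu j); rewrite [mu j - _](_ : _ = rho *: g j); last first.
    by rewrite mu_step addrAC subrr add0r.
  rewrite mu_step !innerE.
  rewrite (_ : rho * (rho * _) / _ = rho / 2 * inner (g j) (g j)); last by field.
  by lra.
have modelE i y : \sum_(j < i) theta R j * (c j + inner y (g j)) =
    \sum_(j < i) theta R j * c j + inner y (\sum_(j < i) theta R j *: g j).
  rewrite inner_sumr -big_split; apply: eq_bigr => j _ /=.
  by rewrite mulrDr innerZr.
elim: k x => [|k IHk] x.
  rewrite !big_ord1 /theta_sum big_ord1 /= theta0 !mul1r.
  have := inner_young (x - lam 0%N) (g 0%N) rho_gt0; have := d_mu 0%N.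
  by rewrite innerDl innerNl; lra.
rewrite [X in _ <= _ + X * _]big_ord_recr /= big_ord_recr /= modelE.
set s := \sum_(i < k.+1) _ *: _ in lam_step IHk *.
set C := \sum_(i < k.+1) theta R i * c i; set E := \sum_(i < k.+1) theta_sum R i.
set v := lam 0%N + rho *: s.
have := IHk v; rewrite modelE -/s -/C -/E.
rewrite [in X in X - _](_ : inner v s = inner (lam 0%N) s + rho * inner s s);
  last by rewrite !innerE.
have -> : inner (v - lam 0%N) (v - lam 0%N) / (2 * rho) = rho / 2 * inner s s.
  by rewrite /v addrAC subrr add0r !innerE; field.
(* The new affine majorant at [mu k] bounds the old dual value, and the ascent bound starts from
   [lam k.+1]; [lam_step] paired with [g k.+1] matches their linear terms. *)
have := ler_wpM2l (ltW (theta_sum_gt0 R k)) (d_le k.+1 (mu k)).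
have := ler_wpM2l (ltW (theta_sum_gt0 R k.+1)) (d_mu k.+1).
have : theta_sum R k.+1 * inner (lam k.+1) (g k.+1) =
    theta_sum R k * inner (mu k) (g k.+1) + theta R k.+1 * inner v (g k.+1).
  by rewrite -!innerZl -innerDl -lam_step.
have := inner_young (x - v) (theta R k.+1 *: g k.+1) rho_gt0.
rewrite innerDl innerNl !innerZr !innerZl.
have -> : inner (x - v) (x - v) / (2 * rho) =
    inner (x - lam 0%N) (x - lam 0%N) / (2 * rho)
    - inner x s + inner (lam 0%N) s + rho / 2 * inner s s.
  rewrite /v !innerE (innerC s x) (innerC s (lam 0%N)) (innerC (lam 0%N) x).
  by field.
move: (inner (x - lam 0%N) (x - lam 0%N) / (2 * rho)) => q.
(* The balance behind the choice of weights: Young's inequality costs [t ^+ 2] and the ascent gains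
   [S + t] times the same squared slope. *)
have := theta_sqr R k.+1; rewrite theta_sumS.
move: (theta_sum R k) (theta R k.+1) (d (mu k)) (d (mu k.+1)) => S t D D'.
move: (c k.+1) => c' S't.
have -> : rho / 2 * (t * (t * inner (g k.+1) (g k.+1))) =
  (S + t) * (rho / 2 * inner (g k.+1) (g k.+1)) by rewrite -S't; ring.
set G := rho / 2 * inner (g k.+1) (g k.+1).
lra.
Qed.

(** * Convexity along segments *)

Section ConvexCombinations.
Variables (R : realType) (n : nat).
Implicit Types (x y : 'cV[R]_n) (t : R).

Lemma convex_function_le (f : 'cV[R]_n -> R) t x y :
  @convex_function R 'cV[R]_n setT f -> 0 <= t -> t <= 1 ->
  f (t *: x + (1 - t) *: y) <= t * f x + (1 - t) * f y.
Proof.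
move=> f_convex t0 t1.
exact: (f_convex (Itv01 t0 t1) x y (in_setT _) (in_setT _)).
Qed.

Lemma convex_set_comb (Z : set 'cV[R]_n) t x y :
  @convex_set R 'cV[R]_n Z -> 0 <= t -> t <= 1 -> Z x -> Z y ->
  Z (t *: x + (1 - t) *: y).
Proof.
move=> Z_convex t0 t1 /mem_set Zx /mem_set Zy.
by have /set_mem := Z_convex x y (Itv01 t0 t1) Zx Zy.
Qed.

(** The form [t *: (y - x) + x] is the argument occurring in the difference quotients of ['D_v]. *)
Lemma convex_function_segment (f : 'cV[R]_n -> R) t x y :
  @convex_function R 'cV[R]_n setT f -> 0 <= t -> t <= 1 ->
  f (t *: (y - x) + x) <= f x + t * (f y - f x).
Proof.
move=> f_convex t0 t1.
have := convex_function_le y x f_convex t0 t1.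
have -> : t *: y + (1 - t) *: x = t *: (y - x) + x.
  by rewrite scalerBl scalerBr scale1r addrA addrAC.
by lra.
Qed.

Lemma convex_set_segment (Z : set 'cV[R]_n) t x y :
  @convex_set R 'cV[R]_n Z -> 0 <= t -> t <= 1 -> Z x -> Z y ->
  Z (t *: (y - x) + x).
Proof.
move=> Z_convex t0 t1 Zx Zy; have := convex_set_comb Z_convex t0 t1 Zy Zx.
by rewrite scalerBl scalerBr scale1r addrA addrAC.
Qed.

End ConvexCombinations.

(** * Minima of continuous functions over compact sets *)

Section CompactMinimum.
Variables (R : realType) (n : nat) (Z : set 'cV[R]_n) (F : 'cV[R]_n -> R).
Hypotheses (Z_nonempty : Z !=set0) (Z_compact : compact Z).
Hypothesis F_continuous : continuous F.

(** Extreme values on a compact set rule out the default value of [set_min]. *)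
Lemma set_min_attained :
  exists z, [/\ Z z, set_min [set F y | y in Z] = F z
               & forall y, Z y -> F z <= F y].
Proof.
have [z /set_mem Zz z_min] := compact_EVT_min Z_nonempty Z_compact
  (continuous_subspaceT F_continuous).
have {}z_min y : Z y -> F z <= F y by move=> Zy; apply/z_min/mem_set.
exists z; split=> //; rewrite /set_min; case: xgetP => [r _ [[y Zy <-] r_lb]|].
  by apply/eqP; rewrite eq_le z_min // andbT r_lb //; exists z.
move=> /(_ (F z)) []; split; first by exists z.
by move=> _ [y Zy <-]; exact: z_min.
Qed.

Lemma set_min_le z : Z z -> set_min [set F y | y in Z] <= F z.
Proof. by have [y [_ -> y_min]] := set_min_attained; apply: y_min. Qed.

Lemma set_min_ge c : (forall z, Z z -> c <= F z) ->
  c <= set_min [set F y | y in Z].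
Proof. by have [y [Zy -> _]] := set_min_attained; apply. Qed.

End CompactMinimum.

(** * First-order inequalities and gradients *)

Lemma linear_coef_ge0 (R : realType) (a c : R) :
  (forall t, 0 < t -> t <= 1 -> 0 <= t * a + t ^+ 2 * c) -> 0 <= a.
Proof.
move=> h; rewrite leNgt; apply/negP => a0.
have c0 : 0 <= `|c| by []. have cc := ler_norm c.
(* This [t] solves [a + t * |c| = t * a], so a negative [a] makes [a + t * c] negative too. *)
pose t := - a / (`|c| - a).
have d0 : 0 < `|c| - a by lra.
have t0 : 0 < t by rewrite divr_gt0 //; lra.
have tE : t * (`|c| - a) = - a by rewrite /t divfK // lt0r_neq0.
have t1 : t <= 1 by rewrite /t ler_pdivrMr // mul1r; lra.
have := h t t0 t1; rewrite expr2 -mulrA -mulrDr pmulr_rge0 //; nra.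
Qed.

Lemma derive_le (R : realType) (n : nat) (F : 'cV[R]_n -> R) (z v : 'cV[R]_n)
    (a c : R) : derivable F z v ->
  (forall t, 0 < t -> t <= 1 -> F (t *: v + z) - F z <= t * a + t ^+ 2 * c) ->
  'D_v F z <= a.
Proof.
move=> dF h.
have cv : h^-1 *: (F (h *: v + z) - F z) @[h --> 0^'+] --> 'D_v F z.
  by apply: cvg_dnbhs_at_right.
have ca : (a + t * c) @[t --> 0^'+] --> a.
  rewrite -[X in _ --> X]addr0 -[X in _ --> _ + X](mul0r c).
  apply: cvgD; first exact: cvg_cst.
  by apply: cvgMl; apply: cvg_at_right_filter; exact: cvg_id.
apply: ler_cvg_to cv ca _; near=> t.
have t0 : 0 < t by near: t; exact: nbhs_right_gt.
have t1 : t <= 1 by near: t; exact: nbhs_right_le.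
rewrite /GRing.scale /= ler_pdivrMl // mulrDr mulrA -expr2; exact: h.
Unshelve. all: by end_near. Qed.

(** [grad] only collects partial derivatives; linearity of the differential extends them to every
    direction. *)
Lemma inner_grad (R : realType) (n : nat) (F : 'cV[R]_n -> R) (z v : 'cV[R]_n) :
  differentiable F z -> inner (grad F z) v = 'D_v F z.
Proof.
move=> dF; rewrite deriveE //.
have {2}-> : v = \sum_(i < n) v i 0 *: delta_mx i 0.
  rewrite {1}[v]matrix_sum_delta; apply: eq_bigr => i _.
  by rewrite big_ord1.
rewrite linear_sum; apply: eq_bigr => i _.
by rewrite mxE deriveE // linearZ /= mulrC.
Qed.

(** * The augmented dual function, its inexact oracle, and strong duality *)

Section AugmentedDual.
Variables (R : realType) (m n : nat).
Variables (f : 'cV[R]_n -> R) (A : 'M[R]_(m, n)) (b : 'cV[R]_m).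
Variable Z : set 'cV[R]_n.
Hypotheses (f_convex : @convex_function R 'cV[R]_n setT f)
  (f_diff : forall z, differentiable f z).
Hypotheses (Z_nonempty : Z !=set0) (Z_compact : compact Z)
  (Z_convex : @convex_set R 'cV[R]_n Z).

Implicit Types (z y : 'cV[R]_n) (l : 'cV[R]_m) (rho : R).

Local Notation res z := (A *m z - b).

Lemma differentiable_res i z : differentiable (fun y => res y i 0) z.
Proof.
rewrite (_ : (fun y => _) = (fun y => (\sum_(j < n) A i j *: y j 0) - b i 0)).
  apply: differentiableB => //; rewrite -fct_sumE.
  apply: differentiable_sum => j; apply: differentiableZ.
  exact: differentiable_coord.
by apply/funext => y; rewrite !mxE.
Qed.

Lemma differentiable_aug rho l z :
  differentiable (fun y => aug_lagrangian f A b rho y l) z.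
Proof.
rewrite (_ : (fun y => _) = (fun y => f y +
    \sum_(i < m) (l i 0 *: res y i 0 + rho / 2 *: (res y i 0 * res y i 0)))).
  apply: differentiableD => //; rewrite -fct_sumE.
  apply: differentiable_sum => i; apply: differentiableD.
    by apply: differentiableZ; exact: differentiable_res.
  by apply: differentiableZ; apply: differentiableM; exact: differentiable_res.
apply/funext => y; rewrite /aug_lagrangian sqr_enorm big_split /= addrA.
by rewrite -scaler_sumr.
Qed.

Lemma continuous_aug rho l : continuous (fun y => aug_lagrangian f A b rho y l).
Proof. by move=> z; apply/differentiable_continuous/differentiable_aug. Qed.

Lemma aug_lagrangian0 z l : aug_lagrangian f A b 0 z l = f z + inner l (res z).
Proof. by rewrite /aug_lagrangian !mul0r addr0. Qed.

(** With penalty parameter 0, the ordinary dual inherits the bounds proved for [aug_dual]. *)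
Lemma lagrange_dualE l : lagrange_dual f A b Z l = aug_dual f A b Z 0 l.
Proof.
by rewrite /aug_dual; under eq_imagel do rewrite aug_lagrangian0.
Qed.

Lemma aug_dual_le rho l z : Z z ->
  aug_dual f A b Z rho l <= aug_lagrangian f A b rho z l.
Proof. by apply: set_min_le => //; exact: continuous_aug. Qed.

Lemma aug_dual_ge rho l c :
  (forall z, Z z -> c <= aug_lagrangian f A b rho z l) ->
  c <= aug_dual f A b Z rho l.
Proof. by apply: set_min_ge => //; exact: continuous_aug. Qed.

Lemma lagrange_dual_le_aug rho l : 0 <= rho ->
  lagrange_dual f A b Z l <= aug_dual f A b Z rho l.
Proof.
move=> rho0; apply: aug_dual_ge => z Zz; rewrite lagrange_dualE.
apply: le_trans (aug_dual_le 0 l Zz) _.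
by rewrite aug_lagrangian0 lerDl mulr_ge0 ?sqr_ge0 ?divr_ge0.
Qed.

(** Convexity bounds [f] by its chord, and the other terms are exactly quadratic in [t]. The
    coefficient of [t] then feeds both [derive_le] and [linear_coef_ge0]. *)
Lemma aug_lagrangian_segment rho l z y t : 0 <= t -> t <= 1 ->
  aug_lagrangian f A b rho (t *: (y - z) + z) l
    - aug_lagrangian f A b rho z l
  <= t * (f y - f z + inner (l + rho *: res z) (A *m (y - z)))
     + t ^+ 2 * (rho / 2 * inner (A *m (y - z)) (A *m (y - z))).
Proof.
move=> t0 t1; have := convex_function_segment z y f_convex t0 t1.
rewrite /aug_lagrangian !sqr_enorm.
have -> : res (t *: (y - z) + z) = t *: (A *m (y - z)) + res z.
  by rewrite mulmxDr -scalemxAr addrA.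
move: (A *m (y - z)) (res z) => w r.
rewrite !innerE (innerC r w); move: (inner _ _) => *; nra.
Qed.

(* [l + rho *: res z] is the multiplier that turns the approximate first-order
   condition at [z] into a lower bound on [f] alone. *)
Lemma stationary_lower_bound rho l z delta y : Z y ->
  (forall y, Z y ->
     - delta <= inner (grad_aug_lagrangian f A b rho z l) (y - z)) ->
  f z - inner (l + rho *: res z) (res y - res z) - delta <= f y.
Proof.
move=> Zy /(_ y Zy); rewrite inner_grad; last exact: differentiable_aug.
have -> : res y - res z = A *m (y - z).
  by rewrite mulmxBr opprB addrA subrK.
have := @derive_le _ _ (fun y => aug_lagrangian f A b rho y l) z (y - z) _ _
  (diff_derivable (v := y - z) (differentiable_aug rho l z))
  (fun t t0 t1 => aug_lagrangian_segment rho l z y (ltW t0) t1).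
by move=> h1 h2; have := le_trans h2 h1; lra.
Qed.

Lemma aug_dual_oracle rho l z delta x : 0 < rho ->
  (forall y, Z y ->
     - delta <= inner (grad_aug_lagrangian f A b rho z l) (y - z)) ->
  f z + rho / 2 * inner (res z) (res z) + inner x (res z) - delta
    - inner (x - l) (x - l) / (2 * rho)
  <= aug_dual f A b Z rho x.
Proof.
move=> rho0 z_stat; apply: aug_dual_ge => y Zy.
have := stationary_lower_bound Zy z_stat.
rewrite /aug_lagrangian sqr_enorm.
(* The penalty at [y] and the [rho *: res z] part of the multiplier combine into [rho / 2] times the
   squares of [res z] and of [res y - res z]; the latter absorbs the cross term with [x - l]. *)
have := inner_young (l - x) (res y - res z) rho0.
rewrite -[l - x]opprB innerNl [inner (- _) (- _)]innerNl innerNr opprK.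
move: (inner (x - l) (x - l) / _) => q.
move: (res z) (res y) => r w.
rewrite !innerE (innerC w r); lra.
Qed.

(* If [y] minimises the penalised objective [f + c/2 |A z - b|^2] then it also
   minimises the ordinary Lagrangian with multiplier [c (A y - b)]. *)
Lemma penalty_lagrange_dual_ge (c : R) : 0 <= c ->
  exists z, [/\ Z z, f z <= lagrange_dual f A b Z (c *: res z)
    & forall y, Z y -> f z + c / 2 * inner (res z) (res z)
                         <= f y + c / 2 * inner (res y) (res y)].
Proof.
move=> c0.
have augE y : aug_lagrangian f A b c y 0 = f y + c / 2 * inner (res y) (res y).
  by rewrite /aug_lagrangian innerC inner0r addr0 sqr_enorm.
have [z [Zz _ z_min]] :=
  set_min_attained Z_nonempty Z_compact (@continuous_aug c 0).
exists z; split=> // [|y Zy]; last by rewrite -!augE z_min.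
rewrite lagrange_dualE; apply: aug_dual_ge => y Zy; rewrite aug_lagrangian0.
have : 0 <= f y - f z + inner (0 + c *: res z) (A *m (y - z)).
  apply: (@linear_coef_ge0 _ _ (c / 2 * inner (A *m (y - z)) (A *m (y - z)))).
  move=> t t0 t1; apply: le_trans (aug_lagrangian_segment c 0 z y (ltW t0) t1).
  by rewrite subr_ge0 z_min //; apply: convex_set_segment => //; exact: ltW.
have -> : A *m (y - z) = res y - res z.
  by rewrite mulmxBr opprB addrA subrK.
(* The first-order inequality puts the Lagrangian at [y] above [f z] plus [c] times the square of
   [res z], and the square is dropped. *)
have := inner_ge0 (res z).
rewrite add0r !innerZl [inner _ (_ - res z)]innerDr [inner _ (- res z)]innerNr.
by move: (inner (res z) (res z)) (inner (res z) (res y)) => *; nra.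
Qed.

Lemma feasible_compact : compact (feasible A b Z).
Proof.
rewrite (_ : feasible A b Z =
  Z `&` \bigcap_(i in [set: 'I_m]) [set z | res z i 0 = 0]).
  apply: compact_closedI => //; apply: closed_bigI => i _.
  apply: (@closed_comp _ _ (fun z => res z i 0) [set 0]); last exact: closed_eq.
  by move=> z _; apply/differentiable_continuous/differentiable_res.
apply/seteqP; split=> z /= [].
  by move=> Az Zz; split=> // i _ /=; rewrite Az subrr mxE.
move=> Zz h; split=> //; apply/eqP; rewrite -subr_eq0; apply/eqP/matrixP => i j.
by rewrite ord1 (h i I) mxE.
Qed.

Lemma primal_value_attained z0 : feasible A b Z z0 ->
  exists z, [/\ feasible A b Z z, primal_value f A b Z = f z
               & forall y, feasible A b Z y -> f z <= f y].
Proof.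
move=> z0_feas; apply: set_min_attained; first by exists z0.
  exact: feasible_compact.
by move=> z; apply: differentiable_continuous.
Qed.

(* Below level [p - eps] the residual is bounded away from 0 by compactness, so
   a large penalty forces its minimiser above that level. *)
Lemma lagrange_dual_approx z0 eps : feasible A b Z z0 -> 0 < eps ->
  exists l, primal_value f A b Z - eps <= lagrange_dual f A b Z l.
Proof.
move=> z0_feas eps0.
have [zs [[Azs Zzs] -> zs_min]] := primal_value_attained z0_feas.
have f_cont : continuous f by move=> z; exact: differentiable_continuous.
pose W := Z `&` [set z | f z <= f zs - eps].
have W_compact : compact W.
  apply: compact_closedI => //.
  by apply: (@closed_comp _ _ f [set x | x <= f zs - eps]) => //; exact: closed_le.
have sq_cont : continuous (fun z => inner (res z) (res z)).
  move=> z; apply: differentiable_continuous; rewrite /inner -fct_sumE.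
  by apply: differentiable_sum => i; apply: differentiableM;
    exact: differentiable_res.
have [zm [Zzm _ zm_min]] := set_min_attained Z_nonempty Z_compact f_cont.
have [W0|/nonemptyPn W0] := pselect (W !=set0); last first.
  have [z [Zz z_dual _]] := penalty_lagrange_dual_ge (lexx 0).
  exists (0 *: res z); apply: le_trans z_dual; rewrite leNgt; apply/negP => /ltW fz.
  by have : W z by []; rewrite W0.
have [w [[Zw fw] _ w_min]] := set_min_attained W0 W_compact sq_cont.
have w_gt0 : 0 < inner (res w) (res w).
  rewrite lt0r inner_ge0 andbT inner_eq0; apply/negP; rewrite subr_eq0 => /eqP Aw.
  by have := zs_min w (conj Aw Zw); move: fw => /=; lra.
(* On [W] the penalty is then at least [f zs - f zm + 1], so a minimiser in [W] would have penalised
   value at least [f zs + 1], above that of the feasible [zs]. *)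
pose c := 2 * (f zs - f zm + 1) / inner (res w) (res w).
have c0 : 0 <= c by rewrite divr_ge0 ?inner_ge0 // mulr_ge0 //; have := zm_min zs Zzs; lra.
have [z [Zz z_dual z_min]] := penalty_lagrange_dual_ge c0.
exists (c *: res z); apply: le_trans z_dual; rewrite leNgt; apply/negP => /ltW fz.
have := z_min zs Zzs; rewrite Azs subrr inner0r mulr0 addr0.
have : f zs - f zm + 1 <= c / 2 * inner (res z) (res z).
  apply: le_trans (ler_wpM2l _ (w_min z (conj Zz fz))); last by rewrite divr_ge0.
  by rewrite le_eqVlt; apply/orP; left; apply/eqP; rewrite /c; field; exact: lt0r_neq0.
by have := zm_min z Zz; lra.
Qed.

(** The maximiser dominates the approximate multipliers for every [eps]; weak duality at a primal
    solution gives the converse. *)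
Lemma strong_duality z0 l : feasible A b Z z0 ->
  (forall l', lagrange_dual f A b Z l' <= lagrange_dual f A b Z l) ->
  lagrange_dual f A b Z l = primal_value f A b Z.
Proof.
move=> z0_feas l_max; apply/eqP; rewrite eq_le; apply/andP; split; last first.
  apply/ler_addgt0Pr => eps eps0; have [l' l'_ge] := lagrange_dual_approx z0_feas eps0.
  by have := l_max l'; lra.
have [z [[Az Zz] -> _]] := primal_value_attained z0_feas.
rewrite lagrange_dualE; apply: le_trans (aug_dual_le 0 l Zz) _.
by rewrite aug_lagrangian0 Az subrr inner0r addr0.
Qed.

End AugmentedDual.

(** * Weighted averages of the primal iterates *)

Section ThetaAverage.
Variables (R : realType) (n : nat) (y : nat -> 'cV[R]_n).

Let avg k := (theta_sum R k)^-1 *: \sum_(j < k.+1) theta R j *: y j.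

Let avg0 : avg 0 = y 0%N.
Proof. by rewrite /avg /theta_sum !big_ord1 theta0 invr1 !scale1r. Qed.

Let weight k := theta_sum R k / theta_sum R k.+1.

Let weight_ge0 k : 0 <= weight k.
Proof. by rewrite divr_ge0 ?ltW ?theta_sum_gt0. Qed.

Let weight_le1 k : weight k <= 1.
Proof.
rewrite ler_pdivrMr ?theta_sum_gt0 // mul1r theta_sumS lerDl.
exact/ltW/theta_gt0.
Qed.

Let weightC k : 1 - weight k = theta R k.+1 / theta_sum R k.+1.
Proof.
have := lt0r_neq0 (theta_sum_gt0 R k.+1); rewrite /weight theta_sumS => S0.
by field.
Qed.

(** Two-point updates let membership and Jensen's inequality follow by induction from binary
    convexity. *)
Let avgS k : avg k.+1 = weight k *: avg k + (1 - weight k) *: y k.+1.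
Proof.
rewrite weightC /avg big_ord_recr /= scalerDr !scalerA (mulrC (theta R _)).
by rewrite mulrAC divff ?mul1r // lt0r_neq0 // theta_sum_gt0.
Qed.

Lemma theta_average_in (Z : set 'cV[R]_n) k :
  @convex_set R 'cV[R]_n Z -> (forall j, Z (y j)) ->
  Z ((theta_sum R k)^-1 *: \sum_(j < k.+1) theta R j *: y j).
Proof.
move=> Z_convex Zy; rewrite -/(avg k); elim: k => [|k IHk]; first by rewrite avg0.
by rewrite avgS; apply: convex_set_comb.
Qed.

Lemma theta_average_le (f : 'cV[R]_n -> R) k :
  @convex_function R 'cV[R]_n setT f ->
  theta_sum R k * f ((theta_sum R k)^-1 *: \sum_(j < k.+1) theta R j *: y j)
    <= \sum_(j < k.+1) theta R j * f (y j).
Proof.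
move=> f_convex; rewrite -/(avg k); elim: k => [|k IHk].
  by rewrite avg0 /theta_sum !big_ord1 theta0.
rewrite avgS big_ord_recr /=; apply: le_trans (lerD IHk (lexx _)).
have := convex_function_le (avg k) (y k.+1) f_convex (weight_ge0 k) (weight_le1 k).
rewrite -(ler_pM2l (theta_sum_gt0 R k.+1)) => /le_trans; apply.
rewrite weightC /weight le_eqVlt; apply/orP; left; apply/eqP.
by field; exact/lt0r_neq0/theta_sum_gt0.
Qed.

End ThetaAverage.

(** * Complexity bounds for the dual fast gradient method *)

Lemma diam_ge0 (R : realType) (n : nat) (Z : set 'cV[R]_n) : 0 <= diam Z.
Proof.
rewrite /diam /set_max; case: xgetP => [r _ [[p _ <-] _]|] //.
exact: enorm_ge0.
Qed.

Theorem mainTheorem8 (R : realType) (m n : nat)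
    (f : 'cV[R]_n -> R) (A : 'M[R]_(m, n)) (b : 'cV[R]_m)
    (Z : set 'cV[R]_n) (rho Lp : R)
    (f_convex : @convex_function R 'cV[R]_n setT f)
    (f_diff : forall z, differentiable f z)
    (A_rank : row_free A)
    (Z_nonempty : Z !=set0) (Z_compact : compact Z)
    (Z_convex : @convex_set R 'cV[R]_n Z)
    (rho_gt0 : 0 < rho)
    (Lp_gt0 : 0 < Lp)
    (grad_lipschitz : forall lambda z y,
      enorm (grad_aug_lagrangian f A b rho z lambda
             - grad_aug_lagrangian f A b rho y lambda) <= Lp * enorm (z - y))
    (slater_cq : slater A b Z)
    (fstar Rp Ld : R)
    (fstarE : fstar = primal_value f A b Z)
    (RpE : Rp = diam Z)
    (LdE : Ld = 1 / rho)
    (lambda_star : 'cV[R]_m)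
    (lambda_star_max :
      forall lambda, lagrange_dual f A b Z lambda <= lagrange_dual f A b Z lambda_star)
    (zbar : 'cV[R]_m -> 'cV[R]_n)
    (zbar_in : forall lambda, Z (zbar lambda))
    (eps_out Rd eps_in : R) (lambda0 : 'cV[R]_m) (k_out : nat)
    (eps_out_gt0 : 0 < eps_out)
    (RdE : Rd = enorm (lambda0 - lambda_star))
    (Rd_gt0 : 0 < Rd)
    (k_outE : k_out%:Z = Num.floor (2 * Rd * Num.sqrt (Ld / eps_out)))
    (eps_inE : eps_in =
      3 / (8 * (1 + Num.sqrt (2 * Lp) * Rp) * (k_out%:R + 3)) * eps_out)
    (zbar_approx : forall lambda,
      set_min [set inner (grad_aug_lagrangian f A b rho (zbar lambda) lambda)
                         (z - zbar lambda) | z in Z]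
        >= - ((1 + Num.sqrt (2 * Lp) * Rp) * eps_in))
    (lambda_ mu_ : nat -> 'cV[R]_m)
    (lambda_0 : lambda_ 0%N = lambda0)
    (mu_step : forall k,
      mu_ k = lambda_ k + Ld^-1 *: (A *m zbar (lambda_ k) - b))
    (lambda_step : forall k,
      let a := (theta_sum R k.+1)^-1 * theta R k.+1 in
      lambda_ k.+1 = (1 - a) *: mu_ k
        + a *: (lambda0 + Ld^-1 *:
            \sum_(i < k.+1) theta R i *: (A *m zbar (lambda_ i) - b)))
    (zhat : nat -> 'cV[R]_n)
    (zhatE : forall k, zhat k =
      (theta_sum R k)^-1 *: \sum_(j < k.+1) theta R j *: zbar (lambda_ j)) :
  [/\ fstar - aug_dual f A b Z rho (mu_ k_out) <= eps_out,
      Z (zhat k_out),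
      enorm (A *m zhat k_out - b) <= 3 / Rd * eps_out,
      - ((3 * enorm lambda_star / Rd + 9 * rho / (2 * Rd ^+ 2) * eps_out)
           * eps_out)
        <= f (zhat k_out) - fstar
    & f (zhat k_out) - fstar
        <= (enorm lambda0 ^+ 2 + Rd ^+ 2) / (2 * Rd ^+ 2) * eps_out].
Proof.
have rho0 : rho != 0 by apply: lt0r_neq0.
have Ld0 : 0 < Ld by rewrite LdE div1r invr_gt0.
have LdV : Ld^-1 = rho by rewrite LdE div1r invrK.
have k0 : 0 <= k_out%:R :> R by [].
have [z0 [Zz0 _] Az0] := slater_cq; have z0_feas : feasible A b Z z0 by [].
(* Oracle error left once the factor [1 + Num.sqrt (2 * Lp) * Rp] cancels against the denominator of
   [eps_in]. *)
pose delta := 3 / (8 * (k_out%:R + 3)) * eps_out.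
have deltaE : (1 + Num.sqrt (2 * Lp) * Rp) * eps_in = delta.
  have c0 : 0 < 1 + Num.sqrt (2 * Lp) * Rp.
    by rewrite ltr_pwDl // RpE mulr_ge0 ?sqrtr_ge0 // diam_ge0.
  rewrite eps_inE /delta; field.
  by rewrite !lt0r_neq0 //; lra.
have zbar_stat l y : Z y ->
    - delta <= inner (grad_aug_lagrangian f A b rho (zbar l) l) (y - zbar l).
  move=> Zy; rewrite -deltaE; apply: le_trans (zbar_approx l) _.
  apply: (@set_min_le _ _ _ (fun y => inner _ (y - zbar l))) => //.
  move=> z; apply: differentiable_continuous; rewrite /inner -fct_sumE.
  apply: differentiable_sum => i; apply: differentiableM => //.
  rewrite (_ : (fun y => _) = (fun y : 'cV[R]_n => y i 0 - zbar l i 0)).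
    by apply: differentiableB => //; exact: differentiable_coord.
  by apply/funext => x; rewrite !mxE.
pose d := aug_dual f A b Z rho.
pose g j := A *m zbar (lambda_ j) - b.
pose c j := f (zbar (lambda_ j)) + rho / 2 * inner (g j) (g j).
have d_le j x : d x <= c j + inner x (g j).
  have : d x <= aug_lagrangian f A b rho (zbar (lambda_ j)) x by apply: aug_dual_le.
  by rewrite /aug_lagrangian sqr_enorm -/(g j) -addrA (addrC (inner _ _)) addrA.
have d_ge j x : c j + inner x (g j) - delta
    - inner (x - lambda_ j) (x - lambda_ j) / (2 * rho) <= d x.
  by apply: aug_dual_oracle => // y; exact: zbar_stat.
have lam_step i : theta_sum R i.+1 *: lambda_ i.+1 = theta_sum R i *: mu_ i
    + theta R i.+1 *: (lambda_ 0%N + rho *: \sum_(j < i.+1) theta R j *: g j).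
  have S0 : theta_sum R i.+1 != 0 by rewrite lt0r_neq0 // theta_sum_gt0.
  have := lambda_step i; rewrite /= LdV lambda_0 => ->.
  rewrite scalerDr !scalerA mulrBr mulr1 mulrA divff // mul1r.
  by rewrite [in X in X - _]theta_sumS addrK.
set S := theta_sum R k_out; set G := A *m zhat k_out - b.
have S_gt0 : 0 < S by exact: theta_sum_gt0.
set mu := mu_ k_out; pose C := \sum_(j < k_out.+1) theta R j * c j.
have sumG : \sum_(j < k_out.+1) theta R j *: g j = S *: G.
  rewrite scalerBr /G zhatE scalemxAr scalerA divff ?lt0r_neq0 // scale1r.
  rewrite mulmx_sumr /S /theta_sum scaler_suml -sumrB; apply: eq_bigr => j _.
  by rewrite scalerBr scalemxAr.
have modelE x : \sum_(j < k_out.+1) theta R j * (c j + inner x (g j)) =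
    C + S * inner x G.
  rewrite -innerZr -sumG inner_sumr -big_split; apply: eq_bigr => j _ /=.
  by rewrite mulrDr innerZr.
have estimate x : C + S * inner x G
    - inner (x - lambda0) (x - lambda0) / (2 * rho) <= S * (d mu + 3 / 8 * eps_out).
  rewrite -modelE -lambda_0.
  apply: le_trans (fast_gradient_estimate rho_gt0 d_le d_ge _ lam_step k_out x) _.
    by move=> i; rewrite mu_step LdV.
  rewrite mulrDr lerD2l.
  have delta_ge0 : 0 <= delta by rewrite mulr_ge0 // ?divr_ge0 ?ltW //; lra.
  (* The factor [k_out + 1] is beaten by the [k_out + 3] in [delta], leaving [3 / 8 * eps_out]. *)
  apply: le_trans (ler_wpM2r delta_ge0 (sum_theta_sum_le R k_out)) _.
  rewrite -/S mulrAC mulrC ler_pM2l // /delta mulrA ler_pM2r //.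
  by rewrite mulrA ler_pdivrMr; lra.
have dualE : lagrange_dual f A b Z lambda_star = fstar.
  rewrite fstarE; exact: (strong_duality f_convex f_diff Z_nonempty Z_compact
    Z_convex z0_feas).
have d_mu_le : d mu <= fstar.
  rewrite fstarE; have [z [[Az Zz] -> _]] :=
    primal_value_attained f_diff Z_compact z0_feas.
  have : d mu <= aug_lagrangian f A b rho z mu by apply: aug_dual_le.
  by rewrite /aug_lagrangian sqr_enorm Az subrr !inner0r mulr0 !addr0.
(* [fstar] is the ordinary dual value at [lambda_star], which lies below [aug_dual] and so below
   each affine majorant. *)
have fstar_le_model : S * fstar <= C + S * inner lambda_star G.
  rewrite -modelE /S /theta_sum mulr_suml; apply: ler_sum => j _.
  apply: ler_wpM2l; first exact/ltW/theta_gt0.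
  apply: le_trans (d_le j lambda_star); rewrite -dualE.
  by apply: lagrange_dual_le_aug; last exact: ltW.
have f_zhat_le : S * f (zhat k_out) <= C.
  rewrite zhatE.
  apply: le_trans (theta_average_le (fun j => zbar (lambda_ j)) k_out f_convex) _.
  apply: ler_sum => j _; apply: ler_wpM2l; first exact/ltW/theta_gt0.
  by rewrite lerDl mulr_ge0 ?inner_ge0 // divr_ge0 // ltW.
have Z_zhat : Z (zhat k_out).
  by rewrite zhatE; apply: (theta_average_in (y := fun j => zbar (lambda_ j))).
have fstar_le : fstar <= f (zhat k_out) + inner lambda_star G.
  by rewrite -dualE lagrange_dualE -aug_lagrangian0; apply: aug_dual_le.
(* The floor gives [2 * Rd * s < k_out + 1] with [s ^+ 2 = 1 / (rho * eps_out)], and [S] is at least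
   a quarter of the square of [k_out + 2]. *)
have Rd_sqr_le : Rd ^+ 2 <= S * rho * eps_out.
  have /andP[_] := floor_itv (2 * Rd * Num.sqrt (Ld / eps_out)).
  rewrite -k_outE intrD1 -pmulrn.
  have s_ge0 := sqrtr_ge0 (Ld / eps_out).
  have : Num.sqrt (Ld / eps_out) ^+ 2 * (rho * eps_out) = 1.
    rewrite sqr_sqrtr ?divr_ge0 ?ltW // LdE; field.
    by rewrite rho0 lt0r_neq0.
  move: (Num.sqrt (Ld / eps_out)) s_ge0 => s s_ge0 s_sqr k_gt.
  have S_ge : Rd ^+ 2 * s ^+ 2 <= S.
    apply: le_trans (theta_sum_ge R k_out).
    have : 0 <= Rd * s by rewrite mulr_ge0 // ltW.
    by rewrite -exprMn; nra.
  rewrite -[leLHS]mulr1 -s_sqr mulrA -[leRHS]mulrA ler_wpM2r //.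
  by rewrite mulr_ge0 // ltW.
have Rd_sqrE : inner (lambda_star - lambda0) (lambda_star - lambda0) = Rd ^+ 2.
  by rewrite RdE sqr_enorm -opprB innerNl innerNr opprK.
clearbody G; have G_le : enorm G <= 3 / Rd * eps_out.
  (* This point maximises the left-hand side of [estimate], yielding a quadratic inequality in
     [enorm G]. *)
  have := estimate (lambda0 + (rho * S) *: G).
  rewrite (addrC lambda0) addrK !innerE.
  have -> : rho * S * (rho * S * inner G G) / (2 * rho) =
      S * (S * (rho / 2 * inner G G)) by field.
  have := normr_inner_le (lambda0 - lambda_star) G.
  rewrite -RdE -sqr_enorm ler_norml innerDl innerNl => /andP[CS _] h.
  have {}h : S * rho / 2 * enorm G ^+ 2 <= Rd * enorm G + 3 / 8 * eps_out.
    rewrite -(ler_pM2l S_gt0); nra.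
  rewrite mulrAC ler_pdivlMr // mulrC; move: (enorm_ge0 G) => N0.
  rewrite leNgt; apply/negP => N3.
  (* For [u = Rd * enorm G / eps_out] this reads [u ^+ 2 <= 2 * u + 3 / 4], which fails when
     [u > 3]. *)
  have : (Rd * enorm G) ^+ 2 <= 2 * eps_out * (Rd * enorm G) + 3 / 4 * eps_out ^+ 2.
    rewrite exprMn; apply: le_trans (ler_wpM2r (sqr_ge0 _) Rd_sqr_le) _; nra.
  nra.
have Seps_gt0 : 0 < S * eps_out by rewrite mulr_gt0.
split=> //.
(* The distance term costs [eps_out / 2] and the oracle [3 / 8 * eps_out], together below
   [eps_out]. *)
- have := estimate lambda_star; rewrite Rd_sqrE => h.
  have h2 : Rd ^+ 2 / (2 * rho) <= S * (eps_out / 2).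
    by rewrite ler_pdivrMr ?mulr_gt0 //; lra.
  rewrite -/d -(ler_pM2l S_gt0); lra.
- have := normr_inner_le lambda_star G; rewrite ler_norml => /andP[_ CS].
  have : enorm lambda_star * enorm G <= 3 * enorm lambda_star / Rd * eps_out.
    rewrite (_ : _ / _ * _ = enorm lambda_star * (3 / Rd * eps_out)); last by ring.
    by rewrite ler_wpM2l // enorm_ge0.
  have : 0 <= 9 * rho / (2 * Rd ^+ 2) * eps_out ^+ 2.
    by rewrite mulr_ge0 ?sqr_ge0 // divr_ge0 ?mulr_ge0 ?sqr_ge0 // ltW.
  lra.
(* At [x = 0] the residual disappears; [Rd_sqr_le] rescales the [lambda0] term, and the oracle error
   [3 / 8 * eps_out] fits into the [eps_out / 2] coming from [Rd ^+ 2]. *)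
- have := estimate 0; rewrite innerC inner0r mulr0 addr0 sub0r innerNl innerNr opprK.
  rewrite -sqr_enorm => h.
  have h2 : enorm lambda0 ^+ 2 / (2 * rho) <=
      S * (enorm lambda0 ^+ 2 / (2 * Rd ^+ 2) * eps_out).
    rewrite ler_pdivrMr ?mulr_gt0 //.
    rewrite (_ : S * _ * _ = enorm lambda0 ^+ 2 * (S * rho * eps_out / Rd ^+ 2)).
      by rewrite ler_peMr ?sqr_ge0 // ler_pdivlMr ?exprn_gt0 // mul1r.
    by field; exact: lt0r_neq0.
  rewrite -(ler_pM2l S_gt0).
  have -> : (enorm lambda0 ^+ 2 + Rd ^+ 2) / (2 * Rd ^+ 2) * eps_out =
     enorm lambda0 ^+ 2 / (2 * Rd ^+ 2) * eps_out + eps_out / 2.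
    by field; exact: lt0r_neq0.
  have := ler_wpM2l (ltW S_gt0) d_mu_le; lra.
Qed.
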